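(* Let $N\ge 2$ be an integer and write $N=2l+1$ or $N=2l+2$ with $l\ge 0$ an integer. Let $P_N(\zeta)=\prod_{n=1}^N(\zeta-\zeta_n)$ be a monic complex polynomial of degree $N$, and define the weighted symmetric functions $\Delta_n^N$ of its roots by \[ \binom{N}{n}\Delta_n^N=\sum_{1\le i_1<\dots<i_n\le N}\zeta_{i_1}\zeta_{i_2}\cdots\zeta_{i_n},\qquad 0\le n\le N, \] (so $\Delta_0^N=1$ and $P_N(\zeta)=\sum_{n=0}^N\binom{N}{n}\Delta_n^N\zeta^{N-n}$). Suppose that \[ |\Delta_{N-2}^N|=1\qquad\text{and}\qquad \Delta_n^N=\overline{\Delta_{N-2-n}^N}\,\Delta_{N-2}^N \] for all $1\le n\le l-1$ when $N=2l+1$, and for all $1\le n\le l$ when $N=2l+2$. Suppose moreover that none of the roots $\zeta_n$ lies on the unit circle $|\zeta|=1$. Then the number of roots of $P_N$ (counted with multiplicity) lying inside the unit circle is less than or equal to $1+N/2$.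
   Context: $\overline{w}$ denotes complex conjugation. These relations amount to $N-2$ real conditions on the coefficients of $P_N$, giving a real $(N+2)$-dimensional family of degree $N$ polynomials. *)

(* Defs.v *)
From mathcomp Require Import all_boot all_order all_algebra.
From mathcomp Require Import complex.
From mathcomp Require Import reals.
Set Implicit Arguments. Unset Strict Implicit. Unset Printing Implicit Defensive.
Import Order.TTheory GRing.Theory Num.Theory.
Local Open Scope ring_scope.

Definition esym (C : comRingType) (s : seq C) (n : nat) : C :=
  \sum_(I : {set 'I_(size s)} | #|I| == n) \prod_(i in I) s`_(val i).

Definition Delta (C : fieldType) (s : seq C) (n : nat) : C :=
  esym s n / ('C(size s, n))%:R.

(* Main.v *)
Require Import Defs.
From mathcomp Require Import all_boot all_order all_algebra.
From mathcomp Require Import complex.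
From mathcomp Require Import reals.
From mathcomp Require Import boolp classical_sets functions topology normedtype.
From mathcomp Require Import derive realfun trigo.
From mathcomp Require Import ring lra zify.
Set Implicit Arguments. Unset Strict Implicit. Unset Printing Implicit Defensive.
Import Order.TTheory GRing.Theory Num.Theory.
Import numFieldNormedType.Exports.
Local Open Scope ring_scope.

(** The hypotheses say that [P''] is self-inversive, where
    [P(x) = \prod_z (x + z)] (the sign change of the roots is harmless).  Hence,
    for a suitable constant [v], the function
    [h(t) = v e^(- i (N/2 + 1) t) P(e^(it))] satisfies
    [Im ((D + N/2 + 1) (D + N/2) h) = 0] with [D = - i d/dt].  Writing
    [h = p + i q], this reads [((N + 1) p + q')' = (N/2) (N/2 + 1) q].  So on an
    arc [[a, b]] of the curve [h] lying in the upper half-plane, with endpoints on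
    the real axis, [(N + 1) p + q'] increases while [q' a >= 0 >= q' b]: the arc
    cannot run from the positive to the negative real axis.  But if [k] roots lie
    inside the unit circle, a continuous argument of [h] grows like
    [(k - N/2 - 1) t], and [k > N/2 + 1] would force such an arc. *)

(** * Level crossings of continuous functions and one-sided derivative signs *)

Section Crossing.
Context {R : realType}.
Implicit Types (f phi : R -> R) (a b l u v : R).

(** The point [c] is the supremum of the times in [[a, b]] where [phi] is at most [u]; this set is
    closed, so [c] belongs to it. *)
Lemma last_crossing phi u a b : continuous phi -> a <= b ->
    phi a <= u -> u < phi b ->
  exists c, [/\ a <= c, c < b, phi c = u & forall t, c < t -> t <= b -> u < phi t].
Proof.
move=> cphi ab pa pb.
pose A : set R := [set t | a <= t <= b /\ phi t <= u]%classic.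
have A0 : A a by split; rewrite ?lexx.
have Aub : has_ubound A by exists b => t [/andP[]].
have Asup : has_sup A by split => //; exists a.
have clA : closed A.
  have -> : A = (`[a, b] `&` phi @^-1` [set t | t <= u])%classic.
    by apply/seteqP; split=> t /=; rewrite in_itv.
  apply: closedI; first exact: interval_closed.
  by apply: preimage_closed => [t _|]; [exact: cphi|exact: closed_le].
have [/andP[ac cb] pc] : A (sup A).
  by have := closure_sup Asup.1 Asup.2; rewrite -(closure_id A).1.
set c := sup A in ac cb pc *.
have after t : c < t -> t <= b -> u < phi t.
  move=> ct tb; rewrite ltNge; apply/negP => pt.
  have : t <= c by apply: ub_le_sup => //; split=> //; rewrite tb (le_trans ac) // ltW.
  by rewrite leNgt ct.
have cltb : c < b.
  by rewrite lt_neqAle cb andbT; apply: contraTneq pc => ->; rewrite -ltNge.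
exists c; split => //; apply/eqP; rewrite eq_le pc /=.
(* If [phi c < u], the intermediate value theorem would give a time after [c] with value [u]. *)
rewrite leNgt; apply/negP => pcu.
have [||d] := @IVT R phi c b u cb.
- by apply: continuous_subspaceT.
- by rewrite ge_min ltW //= le_max (ltW pb) orbT.
rewrite in_itv /= => /andP[cd db] pd.
have cd' : c < d.
  by rewrite lt_neqAle cd andbT; apply: contraTneq pcu => ->; rewrite pd ltxx.
by have := after _ cd' db; rewrite pd ltxx.
Qed.

Lemma upcrossing phi u v a b : continuous phi -> a <= b -> u < v ->
    phi a <= u -> v <= phi b ->
  exists c d, [/\ c < d, phi c = u, phi d = v &
    forall t, c < t < d -> u < phi t < v].
Proof.
move=> cphi ab uv pa pb.
have [c [ac cb pc cP]] := last_crossing cphi ab pa (lt_le_trans uv pb).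
(* Reversing time and sign turns the last crossing of [- v] by [psi] into the first time after [c]
   at which [phi] reaches [v]. *)
pose psi t := - phi (- t).
have cpsi : continuous psi.
  move=> t; apply: continuousN; apply: continuous_comp; last exact: cphi.
  exact: opp_continuous.
have [|||d [bd dc pd dP]] := @last_crossing psi (- v) (- b) (- c) cpsi.
- by rewrite lerN2 ltW.
- by rewrite /psi opprK lerN2.
- by rewrite /psi opprK pc ltrN2.
exists c, (- d); split => //; first by rewrite ltrNr.
  by apply: oppr_inj; rewrite -pd.
move=> t /andP[ct td]; rewrite cP //=; last by rewrite (le_trans (ltW td)) // lerNl.
have := dP (- t); rewrite /psi opprK ltrN2 lerN2 ltrNr => ->//.
exact: ltW.
Qed.

(** The derivative is also the limit of the right difference quotients, which are nonnegative near
    [a]. *)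
Lemma is_derive_right_ge0 f a b l : a < b -> is_derive a 1 f l ->
  (forall t, a < t < b -> f a <= f t) -> 0 <= l.
Proof.
move=> ab df fP.
have cv : (h^-1 *: (f (h *: 1 + a) - f a) @[h --> 0^'] --> l)%classic.
  have -> : l = 'D_1 f a by rewrite derive_val.
  exact: (@ex_derive _ _ _ _ _ _ _ df).
have cv' := cvg_dnbhs_at_right cv.
rewrite -(cvg_lim _ cv') //; apply: limr_ge; first by apply/cvg_ex; exists l.
near=> h.
have h0 : 0 < h by near: h; exact: nbhs_right_gt.
have hb : h < b - a by near: h; apply: nbhs_right_lt; rewrite subr_gt0.
rewrite mulr_ge0 ?invr_ge0 ?(ltW h0) // subr_ge0 [_%:A]mulr1 fP //.
by apply/andP; split; lra.
Unshelve. all: by end_near. Qed.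

Lemma is_derive_left_le0 f a b l : a < b -> is_derive b 1 f l ->
  (forall t, a < t < b -> f b <= f t) -> l <= 0.
Proof.
move=> ab df fP.
have cv : (h^-1 *: (f (h *: 1 + b) - f b) @[h --> 0^'] --> l)%classic.
  have -> : l = 'D_1 f b by rewrite derive_val.
  exact: (@ex_derive _ _ _ _ _ _ _ df).
have cv' := cvg_dnbhs_at_left cv.
rewrite -(cvg_lim _ cv') //; apply: limr_le; first by apply/cvg_ex; exists l.
near=> h.
have h0 : h < 0 by near: h; exact: nbhs_left_lt.
have hb : a - b < h by near: h; apply: nbhs_left_gt; rewrite subr_lt0.
rewrite mulr_le0_ge0 ?invr_le0 ?(ltW h0) // subr_ge0 [_%:A]mulr1 fP //.
by apply/andP; split; lra.
Unshelve. all: by end_near. Qed.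

End Crossing.

(** * The unit circle, polar form and continuous arguments *)

Section Cis.
Context {R : realType}.
Local Open Scope complex_scope.
Local Notation Re := (@complex.Re R).
Local Notation Im := (@complex.Im R).
Implicit Types (s t x : R) (z w c : R[i]).

Definition cis t : R[i] := cos t +i* sin t.

Lemma cis0 : cis 0 = 1.
Proof. by rewrite /cis cos0 sin0. Qed.

Lemma cisD s t : cis (s + t) = cis s * cis t.
Proof. by rewrite /cis cosD sinD; simpc; rewrite [sin s * _ + _]addrC. Qed.

Lemma cisN t : cis (- t) = conjc (cis t).
Proof. by rewrite /cis cosN sinN. Qed.

Lemma cis_neq0 t : cis t != 0.
Proof.
apply/eqP => c0; have := cisD t (- t); rewrite c0 mul0r subrr cis0 => /eqP.
by rewrite oner_eq0.
Qed.

Lemma cisX t n : cis t ^+ n = cis (n%:R * t).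
Proof.
elim: n => [|n IHn]; first by rewrite mul0r cis0.
by rewrite exprS IHn -cisD -[in RHS]natr1; congr cis; ring.
Qed.

Lemma norm_cis t : `|cis t| = 1.
Proof. by rewrite normc_def /= cos2Dsin2 sqrtr1. Qed.

(* Total, but meaningful only for [0 < Re z]. *)
Definition arg0 z : R := atan (Im z / Re z).

Lemma arg0_polar z : 0 < Re z -> exists2 r : R, 0 < r & z = r%:C * cis (arg0 z).
Proof.
case: z => x y /= x0.
pose r := Num.sqrt (1 + (y / x) ^+ 2).
have r0 : 0 < r by rewrite sqrtr_gt0 ltr_pwDl // sqr_ge0.
exists (x * r); first by rewrite mulr_gt0.
have cE : cos (arg0 (x +i* y)) = r^-1 by rewrite /arg0 /= cos_atan.
have c0 : cos (arg0 (x +i* y)) != 0 by rewrite cE invr_eq0 gt_eqF.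
have sE : sin (arg0 (x +i* y)) = y / x * r^-1.
  by have := atanK (y / x); rewrite /tan => {1}<-; rewrite -cE mulfVK.
rewrite /cis cE sE; simpc.
by congr (_ +i* _); field; rewrite ?gt_eqF.
Qed.

Lemma norm_arg0 z : `|arg0 z| <= pi.
Proof.
have := atan_gtNpi2 (Im z / Re z); have := atan_ltpi2 (Im z / Re z).
by rewrite ler_norml /arg0; have := @pi_gt0 R; lra.
Qed.

Lemma Re_1D_gt0 z : `|z| < 1 -> 0 < Re (1 + z).
Proof.
move=> z1; have := le_lt_trans (normc_ge_Re z) z1.
rewrite ltcR => /ltr_normlP[+ _]; case: z {z1} => x y /=; lra.
Qed.

(** The left half-plane is rotated by [pi] onto the right one, where [arg0] applies; on the
    imaginary axis the angle is [pi / 2] or its opposite. *)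
Lemma polar z : z != 0 -> exists2 r : R, 0 < r & exists t, z = r%:C * cis t.
Proof.
have [x0 _|x0 _|x0 z0] := ltgtP 0 (Re z).
- by have [r r0 ->] := arg0_polar x0; exists r => //; exists (arg0 z).
- have [|r r0 E] := @arg0_polar (- z); first by case: z x0 => x y /=; lra.
  exists r => //; exists (arg0 (- z) + pi).
  rewrite cisD mulrA -E /cis cospi sinpi; simpc.
  by case: (z) => x y; simpc.
have : Im z != 0 by apply: contraNneq z0 => y0; rewrite eq_complex /= -x0 y0 eqxx.
case: z x0 {z0} => x y /= <-; case: (ltgtP 0 y) => // y0 _.
- by exists y => //; exists (pi / 2); rewrite /cis cos_pihalf sin_pihalf; simpc.
- exists (- y); rewrite ?oppr_gt0 //; exists (- (pi / 2)).
  by rewrite cisN /cis cos_pihalf sin_pihalf /=; simpc; congr (_ +i* _); ring.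
Qed.

Lemma continuous_arg0 (f : R -> R[i]) :
  continuous (fun t => Re (f t)) -> continuous (fun t => Im (f t)) ->
  (forall t, 0 < Re (f t)) -> continuous (fun t => arg0 (f t)).
Proof.
move=> cr ci f0 t; apply: continuous_comp; last exact: continuous_atan.
by apply: continuousM; [exact: ci|apply: continuousV; [rewrite gt_eqF|exact: cr]].
Qed.

Lemma is_derive_cos_scale s t :
  is_derive t 1 (fun x => cos (s * x)) (- (s * sin (s * t))).
Proof.
have ds : is_derive t 1 (fun x => s * x) s.
  by apply: is_derive_eq (is_deriveZ s (is_derive_id t 1)) _; rewrite [_%:A]mulr1.
by apply: is_derive_eq (is_derive1_comp _ ds) _; rewrite mulNr mulrC.
Qed.

Lemma is_derive_sin_scale s t :
  is_derive t 1 (fun x => sin (s * x)) (s * cos (s * t)).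
Proof.
have ds : is_derive t 1 (fun x => s * x) s.
  by apply: is_derive_eq (is_deriveZ s (is_derive_id t 1)) _; rewrite [_%:A]mulr1.
by apply: is_derive_eq (is_derive1_comp _ ds) _; rewrite mulrC.
Qed.

Lemma is_derive_Re_cis c s t :
  is_derive t 1 (fun x => Re (c * cis (s * x))) (- (s * Im (c * cis (s * t)))).
Proof.
case: c => x y.
have := is_derive_cos_scale s t; have := is_derive_sin_scale s t => ds dc.
apply: is_derive_eq (is_deriveB (is_deriveZ x dc) (is_deriveZ y ds)) _.
by rewrite /= /GRing.scale /=; ring.
Qed.

Lemma is_derive_Im_cis c s t :
  is_derive t 1 (fun x => Im (c * cis (s * x))) (s * Re (c * cis (s * t))).
Proof.
case: c => x y.
have := is_derive_cos_scale s t; have := is_derive_sin_scale s t => ds dc.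
apply: is_derive_eq (is_deriveD (is_deriveZ x ds) (is_deriveZ y dc)) _.
by rewrite /= /GRing.scale /=; ring.
Qed.

Lemma is_derive_continuous (f df : R -> R) :
  (forall t, is_derive t 1 f (df t)) -> continuous f.
Proof. by move=> fP t; apply/differentiable_continuous/derivable1_diffP. Qed.

Lemma continuous_arg0_1D c s : `|c| < 1 ->
  continuous (fun t => arg0 (1 + c * cis (s * t))).
Proof.
move=> c1; apply: continuous_arg0 => [t|t|t].
- under eq_fun do rewrite raddfD /=.
  apply: continuousD; first exact: cst_continuous.
  exact: is_derive_continuous (is_derive_Re_cis c s) _.
- under eq_fun do rewrite raddfD /=.
  apply: continuousD; first exact: cst_continuous.
  exact: is_derive_continuous (is_derive_Im_cis c s) _.
- by apply: Re_1D_gt0; rewrite normrM norm_cis mulr1.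
Qed.

(** [phi] is a continuous argument of [f], and [d] its mean growth rate. The bounded error replaces
    an exact winding number, so [f] need not be periodic and [d] may be any real. *)
Definition is_lift (f : R -> R[i]) (phi : R -> R) (d : R) :=
  [/\ continuous phi, exists B, forall t, `|phi t - d * t| <= B &
      forall t, exists2 r : R, 0 < r & f t = r%:C * cis (phi t)].

Lemma is_liftM f g phi psi d e : is_lift f phi d -> is_lift g psi e ->
  is_lift (fun t => f t * g t) (fun t => phi t + psi t) (d + e).
Proof.
move=> [cf [B fB] fE] [cg [C gC] gE]; split.
- by move=> t; apply: continuousD; [exact: cf|exact: cg].
- exists (B + C) => t; apply: le_trans (lerD (fB t) (gC t)).
  by rewrite mulrDl opprD addrACA ler_normD.
move=> t; have [r r0 ->] := fE t; have [s s0 ->] := gE t.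
exists (r * s); first by rewrite mulr_gt0.
by rewrite cisD rmorphM /= mulrACA.
Qed.

Lemma is_lift_cst z : z != 0 -> exists phi, is_lift (fun=> z) phi 0.
Proof.
move=> /polar[r r0 [t ->]]; exists (fun=> t); split.
- by move=> x; exact: cst_continuous.
- by exists `|t| => x; rewrite mul0r subr0.
by move=> _; exists r.
Qed.

Lemma is_lift_cis s : is_lift (fun t => cis (s * t)) (fun t => s * t) s.
Proof.
split.
- by move=> t; apply: continuousM; [exact: cst_continuous|exact: cvg_id].
- by exists 0 => t; rewrite subrr normr0.
by move=> t; exists 1 => //; rewrite mul1r.
Qed.

(** The curve stays in the right half-plane, so its argument is bounded and the rate is 0. *)
Lemma is_lift_1D c s : `|c| < 1 ->
  is_lift (fun t => 1 + c * cis (s * t)) (fun t => arg0 (1 + c * cis (s * t))) 0.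
Proof.
move=> c1; split.
- exact: continuous_arg0_1D.
- by exists pi => t; rewrite mul0r subr0 norm_arg0.
by move=> t; apply/arg0_polar/Re_1D_gt0; rewrite normrM norm_cis mulr1.
Qed.

Lemma eq_is_lift f g phi d : f =1 g -> is_lift f phi d -> is_lift g phi d.
Proof. by move=> fg [? ? fE]; split=> // t; rewrite -fg. Qed.

(** If [|z| < 1], factoring out [cis t] leaves a factor of rate 0, so the rate is 1; if [|z| > 1],
    factoring out the constant [z] gives rate 0. The boolean is read as 0 or 1, so that rates add up
    to a count. *)
Lemma is_lift_linear z : `|z| != 1 ->
  exists phi, is_lift (fun t => cis t + z) phi (`|z| < 1)%R%:R.
Proof.
have [z1 _|z1 _|//] := real_ltgtP (normr_real z) (real1 _).
- exists (fun t => 1 * t + arg0 (1 + z * cis (- 1 * t))).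
  rewrite -[1%:R](addr0 (1 : R)).
  apply: eq_is_lift (is_liftM (is_lift_cis 1) (is_lift_1D (- 1) z1)) => t.
  by rewrite mulrDr mulr1 mulrCA -cisD mul1r mulN1r subrr cis0 mulr1.
have z0 : z != 0 by apply: contraTneq z1 => ->; rewrite normr0 ltr10.
have [phi phiP] := is_lift_cst z0.
have V1 : `|z^-1| < 1 by rewrite normfV invf_lt1 // (lt_trans ltr01).
have := is_liftM phiP (is_lift_1D 1 V1); rewrite addr0 => L.
eexists; apply: eq_is_lift L => t.
by rewrite mulrDr mulr1 mulVKf // mul1r addrC.
Qed.

Lemma is_lift_prod (zs : seq R[i]) : (forall z, z \in zs -> `|z| != 1) ->
  exists phi, is_lift (fun t => \prod_(z <- zs) (cis t + z)) phi
    (count (fun z : R[i] => `|z| < 1) zs)%:R.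
Proof.
elim: zs => [|z zs IH] zsP /=.
  have [phi phiP] := is_lift_cst (oner_neq0 _).
  by exists phi; apply: eq_is_lift phiP => t; rewrite big_nil.
have [phi phiP] := is_lift_linear (zsP z (mem_head _ _)).
have [|psi psiP] := IH; first by move=> w wz; rewrite zsP // inE wz orbT.
exists (fun t => phi t + psi t); rewrite natrD.
by apply: eq_is_lift (is_liftM phiP psiP) => t; rewrite big_cons.
Qed.

End Cis.

(** * A differential relation that excludes positive winding *)

Section Winding.
Context {R : realType}.
Local Open Scope complex_scope.
Local Notation Re := (@complex.Re R).
Local Notation Im := (@complex.Im R).

Lemma nonpositive_winding (h : R -> R[i]) (dq : R -> R) (k alpha : R)
    (phi : R -> R) (d : R) :
    0 < k -> 0 <= alpha ->
    (forall t : R, is_derive t 1 (fun x => Im (h x)) (dq t)) ->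
    (forall t : R, is_derive t 1 (fun x => k * Re (h x) + dq x) (alpha * Im (h t))) ->
  is_lift h phi d -> d <= 0.
Proof.
move=> k0 alpha0 hq hG [cphi [B phiB] hE]; rewrite leNgt; apply/negP => d0.
have B0 : 0 <= B := le_trans (normr_ge0 _) (phiB 0).
have pi0 := @pi_gt0 R.
(* As [phi t] is within [B] of [d * t], it is at most 0 at [- B / d] and at least [pi] at
   [(B + pi) / d]. Between [a] and [b] the curve lies in the open upper half-plane. *)
have [||||a [b [ab pa pb pab]]] := @upcrossing R phi 0 pi (- B / d) ((B + pi) / d) cphi.
- by rewrite ler_pM2r ?invr_gt0 //; lra.
- exact: pi_gt0.
- have := phiB (- B / d); rewrite [d * _]mulrC divfK ?gt_eqF // ler_norml; lra.
- have := phiB ((B + pi) / d); rewrite [d * _]mulrC divfK ?gt_eqF // ler_norml; lra.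
have pa0 : 0 < Re (h a).
  by have [r r0 ->] := hE a; rewrite pa cis0 mulr1.
have pb0 : Re (h b) < 0.
  have [r r0 ->] := hE b; rewrite pb /cis cospi sinpi; simpc.
  by rewrite /= oppr_lt0.
have qa0 : Im (h a) = 0.
  by have [r r0 ->] := hE a; rewrite pa cis0 mulr1.
have qb0 : Im (h b) = 0.
  have [r r0 ->] := hE b; rewrite pb /cis cospi sinpi; simpc.
  by rewrite /= ?(mulr0, mul0r, addr0).
have q0 t : a < t < b -> 0 < Im (h t).
  move=> /pab /andP[p0 ppi].
  have [r r0 ->] := hE t; rewrite /cis; simpc; rewrite /=.
  by rewrite ?(mul0r, addr0) mulr_gt0 // sin_gt0_pi // p0.
have da : 0 <= dq a.
  by apply: is_derive_right_ge0 ab (hq a) _ => t /q0; rewrite qa0 => /ltW.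
have db : dq b <= 0.
  by apply: is_derive_left_le0 ab (hq b) _ => t /q0; rewrite qb0 => /ltW.
have [|c] := @MVT_segment R (fun t => k * Re (h t) + dq t)
  (fun t => alpha * Im (h t)) a b (ltW ab).
  by apply: continuous_subspaceT => t; exact: (is_derive_continuous hG).
rewrite in_itv /= => /andP[ac cb] E.
(* The mean value point may be an endpoint, where [Im h] vanishes. *)
have qc : 0 <= Im (h c).
  have [->|ca] := eqVneq c a; first by rewrite qa0.
  have [->|bc] := eqVneq c b; first by rewrite qb0.
  by apply/ltW/q0; rewrite !lt_neqAle ac cb eq_sym ca bc.
have : 0 <= alpha * Im (h c) * (b - a).
  by rewrite !mulr_ge0 // subr_ge0 ltW.
(* The increment of [k * Re h + dq] is thus nonnegative, yet its value is positive at [a] and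
   negative at [b]. *)
rewrite -E; nra.
Qed.

End Winding.

(** * Expansion of a product of linear factors *)

Section Esym.

(** Distributing the product gives one term per set of indices where the root is chosen; these sets
    are grouped by cardinality. *)
Lemma prod_esym (C : comNzRingType) (s : seq C) (x : C) :
  \prod_(z <- s) (x + z) = \sum_(n < (size s).+1) Defs.esym s n * x ^+ (size s - n).
Proof.
rewrite (big_nth 0) big_mkord.
under eq_bigr do rewrite addrC.
rewrite bigA_distr /=.
rewrite (partition_big (fun J : {set 'I_(size s)} => inord #|J| : 'I_(size s).+1)
  predT) //=.
apply: eq_bigr => n _; rewrite /Defs.esym mulr_suml.
apply: eq_big => [J|J].
  by rewrite -val_eqE /= inordK // ltnS -[X in (_ <= X)%N]card_ord max_card.
rewrite -val_eqE /= inordK; last first.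
  by rewrite ltnS -[X in (_ <= X)%N]card_ord max_card.
move=> /eqP <-.
rewrite (bigID (mem J)) /=; congr (_ * _).
  by apply: eq_bigr => i ->.
rewrite (eq_bigr (fun=> x)); last by move=> i /negbTE ->.
rewrite prodr_const; congr (_ ^+ _).
have -> : (size s - #|J| = #|~: J|)%N by rewrite -(addKn #|J| #|~: J|) cardsC card_ord.
by apply: eq_card => i; rewrite !inE.
Qed.

Lemma esym0 (C : comNzRingType) (s : seq C) : Defs.esym s 0 = 1.
Proof.
rewrite /Defs.esym (big_pred1 finset.set0) ?big_set0 //.
by move=> I; rewrite cards_eq0.
Qed.

End Esym.

(** * Self-inversive second derivative and the root count *)

Section SelfInversive.
Context {R : realType}.
Local Open Scope complex_scope.
Local Notation Re := (@complex.Re R).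
Local Notation Im := (@complex.Im R).

(** Reversing the order of summation shows that twice the sum is 0. *)
Lemma antisym_sum (V : numDomainType) (n : nat) (f : nat -> V) :
  (forall i, (i <= n)%N -> f (n - i)%N = - f i) -> \sum_(i < n.+1) f i = 0.
Proof.
move=> fN; apply/eqP; rewrite -[_ == 0](mulrn_eq0 _ 2) mulr2n.
rewrite {1}(reindex_inj rev_ord_inj) /= -big_split big1 //= => i _.
by rewrite subSS fN ?addNr // -ltnS.
Qed.

Lemma is_derive_sum_Re_cis (n : nat) (c : nat -> R[i]) (w s : nat -> R) (t : R) :
  is_derive t 1 (fun x => \sum_(i < n) w i * Re (c i * cis (s i * x)))
    (- \sum_(i < n) w i * s i * Im (c i * cis (s i * t))).
Proof.
have -> : (fun x => \sum_(i < n) w i * Re (c i * cis (s i * x))) =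
    \sum_(i < n) ((fun x => w i * Re (c i * cis (s i * x))) : R -> R).
  by apply/funext => x; rewrite fct_sumE.
have D (i : 'I_n) : is_derive t 1 (fun x => w i * Re (c i * cis (s i * x)))
    (w i * - (s i * Im (c i * cis (s i * t)))).
  by apply: is_derive_eq (is_deriveZ (w i) (is_derive_Re_cis (c i) (s i) t)) _.
apply: is_derive_eq (is_derive_sum D) _.
by rewrite -sumrN; apply: eq_bigr => i _; ring.
Qed.

Lemma is_derive_sum_Im_cis (n : nat) (c : nat -> R[i]) (s : nat -> R) (t : R) :
  is_derive t 1 (fun x => \sum_(i < n) Im (c i * cis (s i * x)))
    (\sum_(i < n) s i * Re (c i * cis (s i * t))).
Proof.
have -> : (fun x => \sum_(i < n) Im (c i * cis (s i * x))) =
    \sum_(i < n) ((fun x => Im (c i * cis (s i * x))) : R -> R).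
  by apply/funext => x; rewrite fct_sumE.
by apply: is_derive_sum => i; exact: is_derive_Im_cis.
Qed.

(** With [u = cis t], the conjugate square root [v = cis (- (t / 2))] works, as
    [v * u = cis (t / 2)]. *)
Lemma unit_sqrt_conj (u : R[i]) : `|u| = 1 ->
  exists2 v : R[i], v != 0 & v * u = conjc v.
Proof.
move=> u1; have [|r r0 [t uE]] := @polar R u.
  by rewrite -normr_eq0 u1 oner_neq0.
have r1 : r = 1.
  move: u1; rewrite uE normrM norm_cis mulr1 normc_def /= expr0n addr0.
  by rewrite sqrtr_sqr gtr0_norm // => -[].
exists (cis (- (t / 2))); first exact: cis_neq0.
by rewrite uE r1 mul1r -cisD -cisN; congr cis; lra.
Qed.

(** Both sides equal [(M + 2) (M + 1) 'C(M, n)]: differentiating twice makes the binomial weights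
    symmetric. The proof multiplies by [n! (M - n)!], which turns each side into [(M + 2)!]. *)
Lemma bin_falling2_sym M n : (n <= M)%N ->
  ('C(M.+2, n) * ((M.+2 - n) * (M.+1 - n)) =
   'C(M.+2, M - n) * (n.+2 * n.+1))%N.
Proof.
move=> nM; have F := fact_gt0.
have E1 : ('C(M.+2, n) * (n`! * ((M - n).+2 * ((M - n).+1 * (M - n)`!))) = M.+2`!)%N.
  by rewrite -(bin_fact (leq_trans nM (leqW (leqnSn M)))) subSn ?subSn // leqW.
have E2 : ('C(M.+2, M - n) * ((M - n)`! * (n.+2 * (n.+1 * n`!))) = M.+2`!)%N.
  rewrite -(@bin_fact M.+2 (M - n)) ?(leq_trans (leq_subr _ _)) ?leqW //.
  by have -> : (M.+2 - (M - n) = n.+2)%N by lia.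
have -> : (M.+2 - n = (M - n).+2)%N by lia.
have -> : (M.+1 - n = (M - n).+1)%N by lia.
apply/eqP; rewrite -(@eqn_pmul2r (n`! * (M - n)`!)) ?muln_gt0 ?F //; apply/eqP.
transitivity M.+2`!; [rewrite -E1 | rewrite -E2]; ring.
Qed.

Lemma Im_realM (x : R) (z : R[i]) : Im (x%:C * z) = x * Im z.
Proof. by case: z => a b /=; rewrite mul0r addr0. Qed.

(* The left-hand side is, up to a constant, [Im (e^(-i M t / 2) P''(e^(i t)))]
   for [P] of degree [M + 2] with coefficients ['C(M + 2, n) * b n]. *)
Lemma self_inversive_Im0 (M : nat) (b : nat -> R[i]) (t : R) :
    (forall n, (n <= M)%N -> b (M - n)%N = conjc (b n)) ->
  \sum_(n < M.+3) (M.+2%:R - n%:R) * (M.+1%:R - n%:R) *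
    Im ('C(M.+2, n)%:R * b n * cis ((M%:R / 2 - n%:R) * t)) = 0.
Proof.
(* The terms [n = M + 1] and [n = M + 2] vanish; the others cancel under [n -> M - n], which
   conjugates the term inside [Im]. *)
move=> bP; rewrite big_ord_recr big_ord_recr /= !subrr ?(mulr0, mul0r, addr0).
apply: (antisym_sum (f := fun n => (M.+2%:R - n%:R) * (M.+1%:R - n%:R) *
    Im ('C(M.+2, n)%:R * b n * cis ((M%:R / 2 - n%:R) * t)))) => n nM.
rewrite bP // natrB //.
have -> : (M%:R / 2 - (M%:R - n%:R)) * t = - ((M%:R / 2 - n%:R) * t) :> R by lra.
rewrite cisN.
have E (z w : R[i]) m : Im (m%:R * z * w) = m%:R * Im (z * w).
  by rewrite -mulrA -[m%:R in LHS](rmorph_nat (real_complex R)) Im_realM.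
rewrite !E -rmorphM /=.
have -> (z : R[i]) : Im (conjc z) = - Im z by case: z.
rewrite 2!mulrN !mulrA; congr (- (_ * _)).
have := congr1 (fun k => k%:R : R) (bin_falling2_sym nM).
rewrite !natrM !natrB ?leqW // => H.
by rewrite [RHS]mulrC H -!natr1; ring.
Qed.

(** With [N = M + 2], the curve [h] is [v * cis (- (2 + M / 2) t)] times the product of the
    [cis t + z], so its argument grows at the rate of the count minus [2 + M / 2]. *)
Lemma self_inversive_count (M : nat) (zs : seq R[i]) (b : nat -> R[i]) (v : R[i]) :
    size zs = M.+2 -> v != 0 ->
    (forall n, (n <= M.+2)%N -> v * Defs.esym zs n = 'C(M.+2, n)%:R * b n) ->
    (forall n, (n <= M)%N -> b (M - n)%N = conjc (b n)) ->
    (forall z, z \in zs -> `|z| != 1) ->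
  (count (fun z : R[i] => `|z| < 1) zs)%:R <= 2 + M%:R / 2 :> R.
Proof.
move=> sz v0 vE bP zsP.
pose s n : R := M%:R / 2 - n%:R.
pose c n := 'C(M.+2, n)%:R * b n.
pose h t := \sum_(n < M.+3) c n * cis (s n * t).
have ReE t : Re (h t) = \sum_(n < M.+3) Re (c n * cis (s n * t)).
  by apply: (big_morph Re) => // -[? ?] [? ?].
have ImE t : Im (h t) = \sum_(n < M.+3) Im (c n * cis (s n * t)).
  by apply: (big_morph Im) => // -[? ?] [? ?].
have [phi1 L1] := is_lift_cst v0.
have [phi2 L2] := is_lift_prod zsP.
have L3 := is_lift_cis (- (2 + M%:R / 2) : R).
suff : 0 - (2 + M%:R / 2) + (count (fun z : R[i] => `|z| < 1) zs)%:R <= 0 :> R by lra.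
have L := is_liftM (is_liftM L1 L3) L2.
(* These constants satisfy [s^2 + k s + alpha = (s + M/2 + 1) (s + M/2 + 2)], which at
   [s n = M/2 - n] is [(M + 1 - n) (M + 2 - n)], the weight in [self_inversive_Im0]. *)
apply: (nonpositive_winding (k := M.+3%:R)
  (dq := fun t => \sum_(n < M.+3) s n * Re (c n * cis (s n * t)))
  (alpha := (2 + M%:R / 2) * (1 + M%:R / 2)) _ _ _ _ (eq_is_lift (g := h) _ L)).
- by rewrite ltr0n.
- by rewrite mulr_ge0 // addr_ge0 // divr_ge0.
- move=> t; under eq_fun do rewrite ImE.
  exact: is_derive_sum_Im_cis.
- move=> t.
  have -> : (fun x => M.+3%:R * Re (h x) + \sum_(n < M.+3) s n * Re (c n * cis (s n * x)))
      = (fun x => \sum_(n < M.+3) (M.+3%:R + s n) * Re (c n * cis (s n * x))).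
    apply/funext => x; rewrite ReE mulr_sumr -big_split /=.
    by apply: eq_bigr => n _; rewrite [RHS]mulrDl.
  apply: is_derive_eq (is_derive_sum_Re_cis _ c (fun n => M.+3%:R + s n) s t) _.
  apply/eqP; rewrite eq_sym -subr_eq0 opprK ImE mulr_sumr -big_split /=.
  rewrite -[X in _ == X](self_inversive_Im0 t bP); apply/eqP.
  apply: eq_bigr => n _; rewrite -/(c n) -/(s n) -mulrDl; congr (_ * _).
  by rewrite /s -!natr1; field.
move=> t; rewrite prod_esym sz /h mulr_sumr.
apply: eq_bigr => n _; rewrite /c -vE -1?ltnS // cisX mulrACA -cisD.
congr (_ * cis _).
have nM : (n <= M.+2)%N by rewrite -ltnS.
by rewrite natrB // /s -!natr1; field.
Qed.

End SelfInversive.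

(** * Normalising the coefficients by a constant *)

Theorem mainTheorem1 (R : realType) (N : nat) (zs : seq R[i]) :
  (2 <= N)%N ->
  size zs = N ->
  `|Delta zs (N - 2)| = 1 ->
  (forall n : nat, (1 <= n)%N ->
     (if odd N then (n.+1 <= (N - 1)./2)%N else (n <= (N - 2)./2)%N) ->
     Delta zs n = (Delta zs (N - 2 - n))^* * Delta zs (N - 2)) ->
  (forall z, z \in zs -> `|z| != 1) ->
  (count (fun z : R[i] => `|z| < 1) zs)%:R <= 1 + N%:R / 2 :> R.
Proof.
case: N => [|[|M]] // _ sz u1 DP zsP.
have -> : 1 + M.+2%:R / 2 = 2 + M%:R / 2 :> R by rewrite -!natr1; field.
rewrite subSS subSS subn0 in u1 DP.
have [v v0 vu] := unit_sqrt_conj u1.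
have uu : (Delta zs M)^* * Delta zs M = 1 by rewrite mulrC -normCK u1 expr1n.
(* In both parities the assumed range is [1 <= n] with [2 n <= M]; the case [n = 0] is the condition
   that [Delta zs M] has modulus 1. *)
have sym_half n : (n.*2 <= M)%N ->
    Delta zs n = (Delta zs (M - n))^* * Delta zs M.
  case: n => [_|n nM]; first by rewrite subn0 uu /Delta esym0 bin0 divr1.
  apply: DP => //; case: ifP => oM; lia.
have sym n : (n <= M)%N -> Delta zs n = (Delta zs (M - n))^* * Delta zs M.
  move=> nM; have [|nM2] := leqP n.*2 M; first exact: sym_half.
  (* The upper half follows by conjugating the relation at [M - n]. *)
  have := sym_half (M - n)%N; rewrite subKn // => ->; last lia.
  by rewrite rmorphM /= conjCK -mulrA uu mulr1.
(* As [v * Delta zs M] is the conjugate of [v], multiplying by [v] turns the relations into exact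
   conjugate symmetry of [b]. *)
apply: (self_inversive_count (b := fun n => v * Delta zs n) (v := v) sz) => //.
- move=> n nM; rewrite /Delta sz mulrCA; congr (_ * _).
  by rewrite mulrCA mulfV ?mulr1 // pnatr_eq0 -lt0n bin_gt0.
- move=> n nM; rewrite (sym (M - n)%N) ?leq_subr // subKn //.
  by rewrite mulrCA vu mulrC -rmorphM /=.
Qed.
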